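(* Let $n\geq 1$ be an integer and let $C=\mathrm{Circ}(F_{-1}\mathbb{F}_{0},F_{0}\mathbb{F}_{1},\ldots,F_{n-2}\mathbb{F}_{n-1})$ be the $n\times n$ circulant matrix whose first row is $(F_{k-1}\mathbb{F}_k)_{k=0}^{n-1}$. Then the spectral norm of $C$ is \[ \|C\|_2 = F_n\mathbb{F}_n - n . \]
   Context: $F_n$ denotes the Fibonacci numbers: $F_0=0$, $F_1=1$, $F_{n+1}=F_n+F_{n-1}$ (extended backwards by the same recurrence, so $F_{-1}=1$). The harmonic Fibonacci numbers are $\mathbb{F}_n=\sum_{k=1}^{n}\frac{1}{F_k}$ for $n\geq 1$, with $\mathbb{F}_0=0$. For $c_0,\ldots,c_{n-1}\in\mathbb{C}$, $\mathrm{Circ}(c_0,\ldots,c_{n-1})$ is the $n\times n$ circulant matrix whose $(i,j)$ entry ($0\le i,j\le n-1$) is $c_{(j-i)\bmod n}$, i.e. first row $(c_0,c_1,\ldots,c_{n-1})$ and each subsequent row the cyclic right shift of the previous one. The spectral norm is $\|A\|_2=\sqrt{\max_i \lambda_i(A^HA)}$, where $A^H$ is the conjugate transpose. *)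

(* Defs.v *)
From HB Require Import structures.
From mathcomp Require Import all_boot all_order all_algebra.
From mathcomp Require Import complex.
From mathcomp Require Import classical_sets reals.

Set Implicit Arguments.
Unset Strict Implicit.
Unset Printing Implicit Defensive.

Import Order.TTheory GRing.Theory Num.Theory.

Local Open Scope ring_scope.
Local Open Scope complex_scope.

Fixpoint fib (n : nat) : int :=
  match n with
  | 0%N => 0
  | 1%N => 1
  | (m.+1 as p).+1 => fib p + fib m
  end.

(* fibN m = F_{-m}: the recurrence F_{k+1} = F_k + F_{k-1} solved for F_{k-1},
   i.e. F_{-(m+2)} = F_{-m} - F_{-(m+1)}. *)
Fixpoint fibN (m : nat) : int :=
  match m with
  | 0%N => 0
  | 1%N => 1
  | (k.+1 as p).+1 => fibN k - fibN p
  end.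

Definition fibz (z : int) : int :=
  match z with
  | Posz n => fib n
  | Negz m => fibN m.+1
  end.

Lemma fibzS (z : int) : fibz (z + 1) = fibz z + fibz (z - 1).
Proof.
case: z => [[|n]|[|m]] //.
- have -> : (n.+1%:Z + 1)%R = n.+2 by rewrite -PoszD addn1.
  by have -> : (n.+1%:Z - 1)%R = n by rewrite -addn1 PoszD addrK.
have -> : (Negz m.+1 + 1)%R = Negz m.
  by rewrite !NegzE -(addn1 m.+1) PoszD opprD subrK.
have -> : (Negz m.+1 - 1)%R = Negz m.+2.
  by rewrite !NegzE -(addn1 m.+2) PoszD opprD.
by rewrite /= [RHS]addrC subrK.
Qed.

Definition harmfib (R : realType) (n : nat) : R :=
  \sum_(1 <= k < n.+1) ((fibz k)%:~R)^-1.

(* For i, j < n, (j + n - i) %% n is (j - i) mod n, with no truncated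
   subtraction; only c 0, ..., c (n - 1) are used. *)
Definition circulant (T : Type) (n : nat) (c : nat -> T) : 'M[T]_n :=
  \matrix_(i < n, j < n) c ((j + n - i) %% n)%N.

Definition adjoint_mx (R : realType) (m n : nat) (A : 'M[R[i]]_(m, n)) :
    'M[R[i]]_(n, m) :=
  map_mx Num.conj (A^T).

(* A^H A is Hermitian, so its eigenvalues are real and finitely many; for n > 0
   the sup below is therefore their maximum (see gram_eigenvalue_max). *)
Definition gram_eigenvalues (R : realType) (n : nat) (A : 'M[R[i]]_n) : set R :=
  [set x : R | eigenvalue (adjoint_mx A *m A) x%:C]%classic.

Definition spectral_norm (R : realType) (n : nat) (A : 'M[R[i]]_n) : R :=
  Num.sqrt (sup (gram_eigenvalues A)).

Section GramEigenvalues.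
Variables (R : realType) (n : nat) (A : 'M[R[i]]_n).

Lemma gram_eigenvalue_ge0 (a : R[i]) :
  eigenvalue (adjoint_mx A *m A) a -> 0 <= a.
Proof.
have adjE p q (B : 'M[R[i]]_(p, q)) u :
  (B *m adjoint_mx B) u u = \sum_j `|B u j| ^+ 2.
  by rewrite !mxE; apply: eq_bigr => j _; rewrite !mxE normCK.
case/eigenvalueP => v Ev nzv.
have H : a * (v *m adjoint_mx v) 0 0 =
         ((v *m adjoint_mx A) *m adjoint_mx (v *m adjoint_mx A)) 0 0.
  transitivity ((v *m (adjoint_mx A *m A) *m adjoint_mx v) 0 0).
    by rewrite Ev -scalemxAl [in RHS]mxE.
  rewrite !mulmxA -[in LHS]mulmxA; congr ((_ *m _) 0 0).
  rewrite /adjoint_mx trmx_mul map_mxM; congr (_ *m _).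
  by apply/matrixP => i j; rewrite !mxE -[LHS]conjCK.
move: H; rewrite !adjE => H.
have pos : 0 < \sum_j `|v 0 j| ^+ 2.
  rewrite lt_neqAle eq_sym sumr_ge0 ?andbT; last by move=> j _; rewrite exprn_ge0.
  apply: contra nzv; rewrite psumr_eq0; last by move=> j _; rewrite exprn_ge0.
  move/allP => v0; apply/eqP/rowP => j; rewrite mxE.
  by have := v0 j (mem_index_enum j); rewrite sqrf_eq0 normr_eq0 => /eqP.
by rewrite -(pmulr_lge0 _ pos) H sumr_ge0 // => j _; rewrite exprn_ge0.
Qed.

Lemma gram_eigenvalue_max : (0 < n)%N ->
  gram_eigenvalues A (sup (gram_eigenvalues A)) /\
  forall a : R[i], eigenvalue (adjoint_mx A *m A) a ->
    a <= (sup (gram_eigenvalues A))%:C.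
Proof.
move=> n0; set M := adjoint_mx A *m A.
have [s Es] := closed_field_poly_normal (char_poly M).
have inE a : eigenvalue M a = (a \in s).
  rewrite eigenvalue_root_char Es (monicP (char_poly_monic M)) scale1r.
  exact: root_prod_XsubC.
have cRe a : eigenvalue M a -> a = (complex.Re a)%:C.
  move/gram_eigenvalue_ge0; case: a => x y; rewrite lecE /= => /andP[/eqP -> _].
  by [].
have s0 : s != [::].
  apply/eqP => s0; have := size_char_poly M.
  rewrite Es s0 big_nil (monicP (char_poly_monic M)) scale1r size_poly1.
  by case=> n00; rewrite -n00 in n0.
pose t := map (@complex.Re R) s.
have tE x : gram_eigenvalues A x <-> x \in t.
  rewrite /gram_eigenvalues /= -/M; split => [|/mapP[a as_ ->]].
    by rewrite inE => /(map_f (@complex.Re R)).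
  by rewrite -cRe inE.
have [m mt mM] : exists2 m, m \in t & forall x, x \in t -> x <= m.
  have : t != [::] by rewrite /t; case: (s) s0.
  elim: (t) => // x u IH _; have [->|u0] := eqVneq u [::].
    by exists x; rewrite ?mem_head // => y; rewrite mem_seq1 => /eqP ->.
  have [m mu mM] := IH u0.
  have [xm|mx] := leP x m.
    by exists m => [|y]; rewrite in_cons ?mu ?orbT // => /predU1P[->|/mM].
  exists x => [|y]; rewrite in_cons ?eqxx // => /predU1P[->//|/mM ym].
  exact: le_trans ym (ltW mx).
have -> : sup (gram_eigenvalues A) = m.
  apply/eqP; rewrite eq_le; apply/andP; split.
    by apply: ge_sup => [|x /tE /mM //]; exists m; apply/tE.
  by apply: ub_le_sup; [exists m => x /tE /mM | apply/tE].
split; first exact/tE.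
move=> a ea; rewrite (cRe a ea) lecR; apply/mM/tE.
by rewrite /gram_eigenvalues /= -cRe.
Qed.

End GramEigenvalues.

(* Main.v *)
Require Import Defs.
From HB Require Import structures.
From mathcomp Require Import all_boot all_order all_algebra.
From mathcomp Require Import complex.
From mathcomp Require Import classical_sets reals.

Set Implicit Arguments.
Unset Strict Implicit.
Unset Printing Implicit Defensive.

Import Order.TTheory GRing.Theory Num.Theory.

Local Open Scope ring_scope.
Local Open Scope complex_scope.

(** If all row and column sums of an entrywise nonnegative matrix [A] equal [S],
    then the all-ones vector is an eigenvector of [A^H A] for [S^2], and the
    row sums [S^2] of the nonnegative matrix [A^H A] bound its eigenvalues (l1
    norm of an eigenvector). So [||A||_2 = S]; for a circulant matrix, [S] is the
    sum of the first row, which here telescopes because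
    [F_{k-1} H_k = (F_{k+1} H_{k+1} - 1) - F_k H_k], with [H] the harmonic
    Fibonacci numbers. *)

(** Eigenvectors are row vectors, [v *m M = a *: v]. Summing absolute values over the columns and
    exchanging the sums weights each [|v 0 i|] by the sum of row [i], which is [s]; then the l1 norm
    of [v] cancels. *)
Lemma eigenvalue_norm_le_row_sum (F : numFieldType) (n : nat) (M : 'M[F]_n)
    (s a : F) :
  (forall i j, 0 <= M i j) -> (forall i, \sum_j M i j = s) ->
  eigenvalue M a -> `|a| <= s.
Proof.
move=> M0 Ms /eigenvalueP[v Ev nzv].
have pos : 0 < \sum_j `|v 0 j|.
  rewrite lt_neqAle eq_sym sumr_ge0 // andbT.
  apply: contra nzv; rewrite psumr_eq0 // => /allP v0.
  apply/eqP/rowP => j; rewrite mxE.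
  by have := v0 j (mem_index_enum j); rewrite normr_eq0 => /eqP.
rewrite -(ler_pM2r pos) !mulr_sumr.
under eq_bigr => j _ do rewrite -normrM.
have -> : \sum_j `|a * v 0 j| = \sum_j `|\sum_i v 0 i * M i j|.
  by apply: eq_bigr => j _; move/rowP/(_ j): Ev; rewrite !mxE => ->.
apply: (@le_trans _ _ (\sum_j \sum_i `|v 0 i| * M i j)).
  apply: ler_sum => j _; apply: (le_trans (ler_norm_sum _ _ _)).
  by apply: ler_sum => i _; rewrite normrM (ger0_norm (M0 i j)).
rewrite exchange_big; apply: ler_sum => i _.
by rewrite -mulr_sumr Ms mulrC.
Qed.

Lemma spectral_norm_row_col_sum (R : realType) (n : nat) (A : 'M[R[i]]_n)
    (S : R) :
  (0 < n)%N -> (forall i j, 0 <= A i j) ->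
  (forall i, \sum_j A i j = S%:C) -> (forall j, \sum_i A i j = S%:C) ->
  spectral_norm A = S.
Proof.
move=> n0 A0 Ar Ac.
have S0 : 0 <= S by rewrite -lecR -(Ar (Ordinal n0)) sumr_ge0.
(* In [R[i]], being nonnegative includes being real, so conjugation fixes every entry. *)
have adjE : adjoint_mx A = A^T.
  apply/matrixP => i j; rewrite !mxE; apply: CrealP; exact: ger0_real.
have M0 i j : 0 <= (A^T *m A) i j.
  by rewrite mxE sumr_ge0 // => k _; rewrite mxE mulr_ge0.
have Mr i : \sum_j (A^T *m A) i j = (S ^+ 2)%:C.
  under eq_bigr => j _ do rewrite mxE.
  rewrite exchange_big /=.
  under eq_bigr => k _ do rewrite -mulr_sumr Ar mxE.
  by rewrite -mulr_suml Ac expr2 -rmorphM.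
(* A left all-ones eigenvector needs column sums; symmetry reduces these to the row sums [Mr]. *)
have Msym i j : (A^T *m A) i j = (A^T *m A) j i.
  by rewrite !mxE; apply: eq_bigr => k _; rewrite !mxE mulrC.
have ev : gram_eigenvalues A (S ^+ 2).
  rewrite /gram_eigenvalues /= adjE; apply/eigenvalueP.
  exists (const_mx 1).
    apply/rowP => j; rewrite mxE [in RHS]mxE mxE mulr1 -(Mr j).
    by apply: eq_bigr => i _; rewrite Msym mxE mul1r.
  apply/eqP => /rowP/(_ (Ordinal n0)); rewrite !mxE => /eqP.
  by rewrite oner_eq0.
have ub : ubound (gram_eigenvalues A) (S ^+ 2).
  move=> x; rewrite /gram_eigenvalues /= adjE => ex; rewrite -lecR.
  apply: le_trans (eigenvalue_norm_le_row_sum M0 Mr ex).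
  by apply: real_ler_norm; apply/complex_realP; exists x.
rewrite /spectral_norm (_ : sup _ = S ^+ 2) ?sqrtr_sqr ?ger0_norm //.
apply/eqP; rewrite eq_le ge_sup //=; last by exists (S ^+ 2).
by apply: ub_le_sup => //; exists (S ^+ 2).
Qed.

(** Subtraction in ['I_m.+1] is that of the integers mod [m.+1], so row and column sums become
    reindexings by bijections of this group. *)
Lemma circulantE (T : Type) (m : nat) (c : nat -> T) (i j : 'I_m.+1) :
  circulant m.+1 c i j = c (j - i : 'I_m.+1).
Proof. by rewrite mxE /= modnDmr addnBA // ltnW. Qed.

Lemma circulant_row_sum (V : nmodType) (n : nat) (c : nat -> V) (i : 'I_n) :
  \sum_j circulant n c i j = \sum_(k < n) c k.
Proof.
case: n i => [[] // | m] i.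
rewrite [RHS](reindex_inj (addIr (- i))).
by apply: eq_bigr => j _; rewrite circulantE.
Qed.

Lemma circulant_col_sum (V : nmodType) (n : nat) (c : nat -> V) (j : 'I_n) :
  \sum_i circulant n c i j = \sum_(k < n) c k.
Proof.
case: n j => [[] // | m] j.
rewrite [RHS](reindex_inj (inj_comp (addrI j) oppr_inj)).
by apply: eq_bigr => i _; rewrite circulantE.
Qed.

Lemma spectral_norm_circulant (R : realType) (n : nat) (c : nat -> R) :
  (0 < n)%N -> (forall k, 0 <= c k) ->
  spectral_norm (circulant n (fun k => (c k)%:C)) = \sum_(k < n) c k.
Proof.
move=> n0 c0; apply: spectral_norm_row_col_sum => //.
- by move=> i j; rewrite mxE lecR.
- by move=> i; rewrite circulant_row_sum rmorph_sum.
- by move=> j; rewrite circulant_col_sum rmorph_sum.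
Qed.

Lemma fib_gt0 (n : nat) : 0 < fib n.+1.
Proof.
(* The recurrence has order two, so the induction carries two consecutive values. *)
suff /andP[] : (0 < fib n.+1) && (0 < fib n.+2) by [].
elim: n => // n /andP[f1 f2]; rewrite f2 /=.
exact: addr_gt0 f2 f1.
Qed.

Lemma fib_ge0 (n : nat) : 0 <= fib n.
Proof. by case: n => // n; apply/ltW/fib_gt0. Qed.

Lemma fibz_pred_ge0 (k : nat) : 0 <= fibz (k%:Z - 1).
(* The case [k = 0] computes to [F_{-1} = 1]. *)
Proof. by case: k => // k; rewrite -addn1 PoszD addrK fib_ge0. Qed.

Lemma harmfibS (R : realType) (n : nat) :
  harmfib R n.+1 = harmfib R n + ((fibz n.+1)%:~R)^-1.
Proof. by rewrite /harmfib big_nat_recr. Qed.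

Lemma harmfib_ge0 (R : realType) (n : nat) : 0 <= harmfib R n.
Proof. by apply: sumr_ge0 => k _; rewrite invr_ge0 ler0z fib_ge0. Qed.

Lemma sum_fib_harmfib (R : realType) (n : nat) :
  \sum_(k < n.+1) (fibz (k%:Z - 1))%:~R * harmfib R k =
  (fibz n.+1)%:~R * harmfib R n.+1 - n.+1%:R.
Proof.
have fibV m : (fibz m.+1)%:~R * ((fibz m.+1)%:~R)^-1 = 1 :> R.
  by rewrite mulfV // intr_eq0 gt_eqF // fib_gt0.
elim: n => [|n IH].
  rewrite big_ord1 harmfibS mulrDr fibV /harmfib big_geq //.
  by rewrite !mulr0 add0r subrr.
(* The last term of [harmfib R n.+2], multiplied by [F_{n+2}], gives the 1 that turns [n.+1] into
   [n.+2]. *)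
rewrite big_ord_recr IH (harmfibS R n.+1) mulrDr fibV.
have -> : fibz (n.+2%:Z) = fibz n.+1 + fibz (n.+1%:Z - 1).
  by rewrite -fibzS -PoszD addn1.
rewrite rmorphD mulrDl -[n.+2%:R]natr1 opprD.
by rewrite [- n.+1%:R - 1]addrC addrA addrK /= addrAC.
Qed.

Theorem theorem3p3 (R : realType) (n : nat) (hn : (1 <= n)%N) :
  spectral_norm
    (circulant n (fun k : nat =>
       ((fibz (k%:Z - 1))%:~R * harmfib R k)%:C : R[i])) =
  (fibz n)%:~R * harmfib R n - n%:R.
Proof.
rewrite (spectral_norm_circulant
  (c := fun k => (fibz (k%:Z - 1))%:~R * harmfib R k)) //.
  by case: n hn => // n _; exact: sum_fib_harmfib.
by move=> k; rewrite mulr_ge0 ?harmfib_ge0 // ler0z fibz_pred_ge0.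
Qed.
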